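(* For every fixed $n\in\mathbb{N}$ define the sequence $e_{\lambda}^{(n)}=\{(e_{\lambda}^{(n)})_k\}_{k\in\mathbb{N}}$ by $$(e_{\lambda}^{(n)})_k=\begin{cases}(-1)^{k-n}\dfrac{\lambda_n}{\lambda_k-\lambda_{k-1}}, & n\leq k\leq n+1,\\ 0, & \text{otherwise.}\end{cases}$$ Then: (a) The sequence $(e_{\lambda}^{(0)},e_{\lambda}^{(1)},\ldots)$ is a Schauder basis for the spaces $cs^{\lambda}$ and $cs_0^{\lambda}$, and every $x$ in $cs^{\lambda}$ or in $cs_0^{\lambda}$ has a unique representation of the form $x=\sum_{n=0}^{\infty}\Lambda_n(x)e_{\lambda}^{(n)}$. (b) $bs^{\lambda}$ has no Schauder basis.
   Context: $\mathbb{N}=\{0,1,2,\dots\}$ and $w=\mathbb{C}^{\mathbb{N}}$ is the space of all complex sequences. $\lambda=(\lambda_k)_{k\in\mathbb{N}}$ is a fixed strictly increasing sequence of positive reals tending to infinity, with the convention $\lambda_{-1}=0$. For $x=(x_k)\in w$ put $\Lambda(x)=(\Lambda_n(x))_{n\in\mathbb{N}}$, $\Lambda_n(x)=\frac{1}{\lambda_n}\sum_{k=0}^{n}(\lambda_k-\lambda_{k-1})x_k$. $cs$, $cs_0$, $bs$ are the spaces of sequences $x\in w$ whose sequence of partial sums $\left(\sum_{n=0}^m x_n\right)_m$ is, respectively, convergent, convergent to $0$, bounded. Define $cs^{\lambda}=\{x\in w:\Lambda(x)\in cs\}$, $cs_0^{\lambda}=\{x\in w:\Lambda(x)\in cs_0\}$,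 $bs^{\lambda}=\{x\in w:\Lambda(x)\in bs\}$, each normed by $\|x\|=\sup_m\left|\sum_{n=0}^m\Lambda_n(x)\right|$. If a normed sequence space $X$ contains a sequence $(b_n)$ such that for every $x\in X$ there is a unique sequence of scalars $(\alpha_n)$ with $\lim_{n\to\infty}\|x-(\alpha_0b_0+\cdots+\alpha_nb_n)\|=0$, then $(b_n)$ is called a Schauder basis for $X$, and one writes $x=\sum_k\alpha_kb_k$.
   Formalization: For cs_0^λ only the unique expansion of every x in the norm is stated, not that the e_λ^(n) lie in cs_0^λ: this is false, since Λ(e_λ^(n)) is the n-th unit sequence, whose partial sums tend to 1, so they form no Schauder basis of cs_0^λ in the defined sense. *)

(* Defs.v *)
From Stdlib Require Import Reals Lra Lia.
From Coquelicot Require Import Coquelicot.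

Open Scope R_scope.

(** lambda_k - lambda_{k-1}, with lambda_{-1} = 0. *)
Definition dlam (lam : nat -> R) (k : nat) : R :=
  match k with
  | O => lam O
  | S j => lam (S j) - lam j
  end.

Definition Lambda (lam : nat -> R) (x : nat -> C) (n : nat) : C :=
  Cmult (RtoC (/ lam n))
        (sum_n (fun k => Cmult (RtoC (dlam lam k)) (x k)) n).

Definition cs (x : nat -> C) : Prop :=
  exists l : C, is_series (V := C_NormedModule) x l.

Definition cs0 (x : nat -> C) : Prop :=
  is_series (V := C_NormedModule) x (RtoC 0).

Definition bs (x : nat -> C) : Prop :=
  exists M : R, forall m : nat, Cmod (sum_n x m) <= M.

Definition cs_lam (lam : nat -> R) (x : nat -> C) : Prop := cs (Lambda lam x).
Definition cs0_lam (lam : nat -> R) (x : nat -> C) : Prop := cs0 (Lambda lam x).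
Definition bs_lam (lam : nat -> R) (x : nat -> C) : Prop := bs (Lambda lam x).

(** The supremum is finite exactly on [bs_lam lam], which contains
    [cs_lam lam] and [cs0_lam lam]; outside it [real] returns the meaningless
    value 0. *)
Definition norm_lam (lam : nat -> R) (x : nat -> C) : R :=
  real (Sup_seq (fun m => Finite (Cmod (sum_n (Lambda lam x) m)))).

(** x = sum_k a_k b_k, in the sense of the norm [nrm]. *)
Definition expansion (nrm : (nat -> C) -> R) (b : nat -> nat -> C)
    (a : nat -> C) (x : nat -> C) : Prop :=
  is_lim_seq
    (fun n => nrm (fun j => Cminus (x j) (sum_n (fun k => Cmult (a k) (b k j)) n)))
    0.

Definition unique_expansions (X : (nat -> C) -> Prop) (nrm : (nat -> C) -> R)
    (b : nat -> nat -> C) : Prop :=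
  forall x : nat -> C, X x -> exists! a : nat -> C, expansion nrm b a x.

Definition schauder_basis (X : (nat -> C) -> Prop) (nrm : (nat -> C) -> R)
    (b : nat -> nat -> C) : Prop :=
  (forall n : nat, X (b n)) /\ unique_expansions X nrm b.

Definition e_lam (lam : nat -> R) (n k : nat) : C :=
  if (Nat.leb n k && Nat.leb k (n + 1))%bool
  then RtoC ((-1) ^ (k - n) * (lam n / dlam lam k))
  else RtoC 0.

(** [Lambda lam (e_lam lam n)] is the n-th unit sequence. *)
Lemma Lambda_e_lam (lam : nat -> R)
  (lam_pos : forall k, 0 < lam k) (lam_incr : forall k, lam k < lam (S k))
  (n m : nat) :
  Lambda lam (e_lam lam n) m = if Nat.eqb m n then RtoC 1 else RtoC 0.
Proof.
  assert (dpos : forall k, dlam lam k <> 0).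
  { intros [|k]; simpl.
    - specialize (lam_pos O); lra.
    - specialize (lam_incr k); lra. }
  assert (H : sum_n (fun k => Cmult (RtoC (dlam lam k)) (e_lam lam n k)) m
              = if Nat.eqb m n then RtoC (lam n) else RtoC 0).
  { assert (T : forall k, Cmult (RtoC (dlam lam k)) (e_lam lam n k) =
        RtoC (if Nat.eqb k n then lam n
              else if Nat.eqb k (S n) then - lam n else 0)).
    { intros k. unfold e_lam.
      destruct (Nat.eqb_spec k n) as [->|Hn].
      - rewrite Nat.leb_refl, (proj2 (Nat.leb_le n (n + 1)) ltac:(lia)).
        rewrite Nat.sub_diag. cbn [andb]. rewrite <- RtoC_mult.
        f_equal. simpl. field. apply dpos.
      - destruct (Nat.eqb_spec k (S n)) as [->|Hs].
        + rewrite (proj2 (Nat.leb_le n (S n)) ltac:(lia)).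
          rewrite (proj2 (Nat.leb_le (S n) (n + 1)) ltac:(lia)).
          replace (S n - n)%nat with 1%nat by lia.
          cbn [andb]. rewrite <- RtoC_mult. f_equal. rewrite pow_1.
          field. apply dpos.
        + replace (Nat.leb n k && Nat.leb k (n + 1))%bool with false.
          * apply Cmult_0_r.
          * symmetry. apply Bool.andb_false_iff.
            rewrite !Nat.leb_gt. lia. }
    induction m as [|m IH].
    - rewrite sum_O, T. destruct n; reflexivity.
    - rewrite sum_Sn, IH, T. change plus with Cplus.
      destruct (Nat.eqb_spec m n) as [Hm|Hm];
      destruct (Nat.eqb_spec (S m) n) as [Hm1|Hm1];
      destruct (Nat.eqb_spec (S m) (S n)) as [Hm2|Hm2]; try lia;
      rewrite <- RtoC_plus; f_equal; lra. }
  unfold Lambda. rewrite H.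
  destruct (Nat.eqb_spec m n) as [->|].
  - rewrite <- RtoC_mult. f_equal. field. specialize (lam_pos n); lra.
  - apply Cmult_0_r.
Qed.

Lemma is_series_Lambda_e_lam (lam : nat -> R)
  (lam_pos : forall k, 0 < lam k) (lam_incr : forall k, lam k < lam (S k))
  (n : nat) :
  is_series (V := C_NormedModule) (Lambda lam (e_lam lam n)) (RtoC 1).
Proof.
  assert (S1 : forall m, sum_n (Lambda lam (e_lam lam n)) m =
                         if Nat.leb n m then RtoC 1 else RtoC 0).
  { induction m as [|m IH].
    - rewrite sum_O, (Lambda_e_lam lam lam_pos lam_incr).
      destruct n; reflexivity.
    - rewrite sum_Sn, IH, (Lambda_e_lam lam lam_pos lam_incr).
      change plus with Cplus.
      destruct (Nat.leb_spec n m); destruct (Nat.eqb_spec (S m) n);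
      destruct (Nat.leb_spec n (S m)); try lia;
      rewrite <- RtoC_plus; f_equal; lra. }
  unfold is_series.
  apply filterlim_ext_loc with (f := fun _ => RtoC 1).
  - exists n. intros m Hm. symmetry. etransitivity; [apply S1|].
    rewrite (proj2 (Nat.leb_le n m) Hm). reflexivity.
  - apply filterlim_const.
Qed.

(** The sequences [e_lam lam n] lie in [cs_lam lam] but not in [cs0_lam lam]:
    they are a basis "for" the latter only in the sense of
    [unique_expansions], not of [schauder_basis]. *)
Lemma e_lam_not_cs0_lam (lam : nat -> R)
  (lam_pos : forall k, 0 < lam k) (lam_incr : forall k, lam k < lam (S k))
  (n : nat) : ~ cs0_lam lam (e_lam lam n).
Proof.
  intros H.
  pose proof (is_series_Lambda_e_lam lam lam_pos lam_incr n) as H1.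
  pose proof (filterlim_locally_unique (V := C_NormedModule) (K := C_AbsRing)
    _ _ _ H H1) as E.
  apply RtoC_inj in E. lra.
Qed.

(* Main.v *)
(** Write [S_m] for the [m]-th partial sum of [Lambda lam x]: then [x |-> S]
    maps [bs_lam] isometrically onto the bounded sequences.  The image of
    [e_lam n] is the indicator of [{n, n+1, ...}], so the residual of an
    expansion with coefficients [a] has image [S_m - A_(min n m)], where [A] is
    the sequence of partial sums of [a]; (a) follows because convergent
    sequences are Cauchy.  For (b), the combinations with coefficients in a
    countable dense subset of [C] would be dense among the bounded sequences,
    and a 0/1 sequence obtained by diagonalization is at distance at least 1/2
    from all of them. *)

Require Import Defs.
From Stdlib Require Import Reals Lra Lia Cantor ClassicalEpsilon.
From Stdlib Require Import FunctionalExtensionality.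
From Coquelicot Require Import Coquelicot.

Open Scope R_scope.

(* [ring] does not see that the carriers inferred by [sum_n] are [C]. *)
Ltac C_ring :=
  match goal with |- @eq _ ?x ?y => change (@eq C x y) end; ring.

(** * Partial sums of [Lambda] and residuals of expansions *)

Definition lambda_sum (lam : nat -> R) (x : nat -> C) (m : nat) : C :=
  sum_n (Lambda lam x) m.

(** Convertible with the sequence inside [expansion], so that [change] and [exact] pass between the
    two. *)
Definition residual (b : nat -> nat -> C) (a : nat -> C) (x : nat -> C)
    (n : nat) : nat -> C :=
  fun j => Cminus (x j) (sum_n (fun k => Cmult (a k) (b k j)) n).

(** Linearity is kept in the single form [u + a v], the one in which [residual_O] and [residual_S]
    append a term. *)
Lemma sum_n_Cplus_Cmult (u v : nat -> C) (a : C) (n : nat) :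
  sum_n (fun k => Cplus (u k) (Cmult a (v k))) n
  = Cplus (sum_n u n) (Cmult a (sum_n v n)) :> C.
Proof.
  induction n as [|n IH].
  - now rewrite !sum_O.
  - rewrite !sum_Sn, IH. change plus with Cplus. C_ring.
Qed.

Lemma Lambda_linear (lam : nat -> R) (u v : nat -> C) (a : C) (n : nat) :
  Lambda lam (fun j => Cplus (u j) (Cmult a (v j))) n
  = Cplus (Lambda lam u n) (Cmult a (Lambda lam v n)).
Proof.
  unfold Lambda.
  rewrite (sum_n_ext _ (fun k => Cplus (Cmult (RtoC (dlam lam k)) (u k))
             (Cmult a (Cmult (RtoC (dlam lam k)) (v k))))).
  - rewrite sum_n_Cplus_Cmult. C_ring.
  - intros k. C_ring.
Qed.

Lemma lambda_sum_linear (lam : nat -> R) (u v : nat -> C) (a : C) (m : nat) :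
  lambda_sum lam (fun j => Cplus (u j) (Cmult a (v j))) m
  = Cplus (lambda_sum lam u m) (Cmult a (lambda_sum lam v m)).
Proof.
  unfold lambda_sum. rewrite <- sum_n_Cplus_Cmult.
  apply sum_n_ext. intros k. apply Lambda_linear.
Qed.

Lemma residual_O (b : nat -> nat -> C) (a x : nat -> C) :
  residual b a x 0 = fun j => Cplus (x j) (Cmult (Copp (a O)) (b O j)).
Proof.
  apply functional_extensionality. intros j. unfold residual.
  rewrite sum_O. C_ring.
Qed.

Lemma residual_S (b : nat -> nat -> C) (a x : nat -> C) (n : nat) :
  residual b a x (S n)
  = fun j => Cplus (residual b a x n j) (Cmult (Copp (a (S n))) (b (S n) j)).
Proof.
  apply functional_extensionality. intros j. unfold residual.
  rewrite sum_Sn. change plus with Cplus. C_ring.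
Qed.

Lemma lambda_sum_residual (lam : nat -> R) (b : nat -> nat -> C)
    (a x : nat -> C) (n m : nat) :
  lambda_sum lam (residual b a x n) m
  = Cminus (lambda_sum lam x m)
      (sum_n (fun k => Cmult (a k) (lambda_sum lam (b k) m)) n).
Proof.
  induction n as [|n IH].
  - rewrite residual_O, lambda_sum_linear, sum_O. C_ring.
  - rewrite residual_S, lambda_sum_linear, IH, sum_Sn.
    change plus with Cplus. C_ring.
Qed.

Lemma bs_lam_linear (lam : nat -> R) (u v : nat -> C) (a : C) :
  bs_lam lam u -> bs_lam lam v ->
  bs_lam lam (fun j => Cplus (u j) (Cmult a (v j))).
Proof.
  intros [M HM] [N HN]. exists (M + Cmod a * N). intros m.
  change (Cmod (lambda_sum lam (fun j => Cplus (u j) (Cmult a (v j))) m)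
          <= M + Cmod a * N).
  rewrite lambda_sum_linear.
  eapply Rle_trans; [apply Cmod_triangle|]. rewrite Cmod_mult.
  apply Rplus_le_compat; [apply HM|].
  apply Rmult_le_compat_l; [apply Cmod_ge_0 | apply HN].
Qed.

Lemma bs_lam_residual (lam : nat -> R) (b : nat -> nat -> C)
    (a x : nat -> C) (n : nat) :
  bs_lam lam x -> (forall k, bs_lam lam (b k)) ->
  bs_lam lam (residual b a x n).
Proof.
  intros Hx Hb. induction n as [|n IH].
  - rewrite residual_O. now apply bs_lam_linear.
  - rewrite residual_S. now apply bs_lam_linear.
Qed.

Lemma cs_lam_bs_lam (lam : nat -> R) (x : nat -> C) :
  cs_lam lam x -> bs_lam lam x.
Proof.
  intros H.
  destruct (filterlim_bounded (K := C_AbsRing) (V := C_NormedModule) _ H)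
    as [M HM].
  now exists M.
Qed.

(** * The norm as a supremum *)

Lemma norm_lam_le (lam : nat -> R) (x : nat -> C) (M : R) :
  (forall m, Cmod (lambda_sum lam x m) <= M) -> norm_lam lam x <= M.
Proof.
  intros H. unfold norm_lam.
  pose proof (Sup_seq_correct
    (fun m => Finite (Cmod (sum_n (Lambda lam x) m)))) as HS.
  assert (HM : 0 <= M).
  { eapply Rle_trans; [apply Cmod_ge_0 | apply (H O)]. }
  (* In the infinite cases [real] gives 0, and [HM] closes the goal. *)
  destruct (Sup_seq _) as [l| |]; simpl in *; [|exact HM..].
  apply Rnot_lt_le. intros Hl.
  assert (Hp : 0 < l - M) by lra.
  destruct (HS (mkposreal _ Hp)) as [_ [n Hn]]. simpl in Hn.
  specialize (H n). unfold lambda_sum in H. lra.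
Qed.

(** Membership in [bs_lam] excludes an infinite supremum, for which [norm_lam] would be the default
    value 0. *)
Lemma norm_lam_ge (lam : nat -> R) (x : nat -> C) (m : nat) :
  bs_lam lam x -> Cmod (lambda_sum lam x m) <= norm_lam lam x.
Proof.
  intros [M HM]. unfold norm_lam.
  pose proof (Sup_seq_correct
    (fun m => Finite (Cmod (sum_n (Lambda lam x) m)))) as HS.
  destruct (Sup_seq _) as [l| |]; simpl in HS |- *.
  - apply Rnot_lt_le. intros Hl.
    assert (Hp : 0 < Cmod (lambda_sum lam x m) - l) by lra.
    destruct (HS (mkposreal _ Hp)) as [H _]. specialize (H m).
    simpl in H. unfold lambda_sum in H. lra.
  - destruct (HS M) as [n Hn]. specialize (HM n). lra.
  - specialize (HS 0 O). pose proof (Cmod_ge_0 (sum_n (Lambda lam x) O)). lra.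
Qed.

Lemma sum_n_inj (u v : nat -> C) :
  (forall m, sum_n u m = sum_n v m) -> u = v.
Proof.
  intros H. apply functional_extensionality. intros [|m].
  - specialize (H O). now rewrite !sum_O in H.
  - pose proof (H (S m)) as HS. rewrite !sum_Sn, (H m) in HS.
    change plus with Cplus in HS.
    replace (u (S m)) with (Cminus (Cplus (sum_n v m) (u (S m))) (sum_n v m))
      by C_ring.
    rewrite HS. C_ring.
Qed.

(** * Expansions along [e_lam] *)

Section Basis.

Variable lam : nat -> R.
Hypothesis lam_pos : forall k, 0 < lam k.
Hypothesis lam_incr : forall k, lam k < lam (S k).

Lemma lambda_sum_e_lam (n m : nat) :
  lambda_sum lam (e_lam lam n) m = if Nat.leb n m then RtoC 1 else RtoC 0.
Proof.
  unfold lambda_sum. induction m as [|m IH].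
  - rewrite sum_O, (Lambda_e_lam lam lam_pos lam_incr). now destruct n.
  - rewrite sum_Sn, IH, (Lambda_e_lam lam lam_pos lam_incr).
    change plus with Cplus.
    destruct (Nat.leb_spec n m); destruct (Nat.eqb_spec (S m) n);
    destruct (Nat.leb_spec n (S m)); try lia; C_ring.
Qed.

(** At position [m] only the [e_lam k] with [k <= m] contribute, each with value 1; hence the cut at
    [Nat.min n m]. *)
Lemma lambda_sum_residual_e_lam (a x : nat -> C) (n m : nat) :
  lambda_sum lam (residual (e_lam lam) a x n) m
  = Cminus (lambda_sum lam x m) (sum_n a (Nat.min n m)).
Proof.
  rewrite lambda_sum_residual. f_equal.
  induction n as [|n IH].
  - rewrite !sum_O, lambda_sum_e_lam. simpl. apply Cmult_1_r.
  - rewrite sum_Sn, IH, lambda_sum_e_lam. change plus with Cplus.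
    destruct (Nat.leb_spec (S n) m) as [H|H].
    + rewrite (Nat.min_l n), (Nat.min_l (S n)) by lia.
      rewrite sum_Sn. change plus with Cplus. C_ring.
    + rewrite (Nat.min_r n), (Nat.min_r (S n)) by lia. C_ring.
Qed.

Lemma cs_lam_e_lam (n : nat) : cs_lam lam (e_lam lam n).
Proof. exists (RtoC 1). now apply is_series_Lambda_e_lam. Qed.

Lemma expansion_Lambda (x : nat -> C) :
  cs_lam lam x -> expansion (norm_lam lam) (e_lam lam) (Lambda lam x) x.
Proof.
  intros [l Hl]. unfold expansion. apply is_lim_seq_spec. intros eps.
  (* Two such errors bound every partial sum by [eps / 2]. Passing to the supremum only yields [<=],
     so the other half of [eps] restores strictness. *)
  assert (Hp : 0 < eps / 4) by (destruct eps; simpl; lra).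
  destruct (proj1 (filterlim_locally_ball_norm (K := C_AbsRing)
    (U := C_NormedModule) _ l) Hl (mkposreal _ Hp)) as [N HN].
  assert (HS : forall m, (N <= m)%nat ->
            Cmod (Cminus (lambda_sum lam x m) l) < eps / 4).
  { intros m Hm. exact (HN m Hm). }
  exists N. intros n Hn. rewrite Rminus_0_r.
  change (Rabs (norm_lam lam (residual (e_lam lam) (Lambda lam x) x n)) < eps).
  rewrite Rabs_pos_eq.
  - apply Rle_lt_trans with (eps / 2); [|lra].
    apply norm_lam_le. intros m. rewrite lambda_sum_residual_e_lam.
    change (sum_n (Lambda lam x)) with (lambda_sum lam x).
    destruct (Nat.le_ge_cases n m) as [H|H].
    + rewrite Nat.min_l by lia.
      replace (Cminus (lambda_sum lam x m) (lambda_sum lam x n))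
        with (Cminus (Cminus (lambda_sum lam x m) l)
                     (Cminus (lambda_sum lam x n) l)) by C_ring.
      eapply Rle_trans; [apply Cmod_triangle|]. rewrite Cmod_opp.
      pose proof (HS n Hn). pose proof (HS m ltac:(lia)). lra.
    + rewrite Nat.min_r by lia.
      replace (Cminus _ _) with (RtoC 0) by C_ring. rewrite Cmod_0. lra.
  (* The norm is nonnegative because it dominates a modulus, the residual being in [bs_lam]. *)
  - eapply Rle_trans; [apply Cmod_ge_0|].
    apply norm_lam_ge with (m := O).
    apply bs_lam_residual; [|intros k]; apply cs_lam_bs_lam.
    + now exists l.
    + apply cs_lam_e_lam.
Qed.

(** For fixed [m], the image of the residual at [m] is constant in [n] once [n >= m]. It is
    dominated by norms tending to 0, so it vanishes. *)
Lemma expansion_lambda_sum (a x : nat -> C) :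
  cs_lam lam x -> expansion (norm_lam lam) (e_lam lam) a x ->
  forall m, lambda_sum lam x m = sum_n a m.
Proof.
  intros Hx Ha m.
  assert (H : Cmod (Cminus (lambda_sum lam x m) (sum_n a m)) <= 0).
  { apply (is_lim_seq_le_loc
             (fun _ => Cmod (Cminus (lambda_sum lam x m) (sum_n a m)))
             (fun n => norm_lam lam (residual (e_lam lam) a x n))
             (Cmod (Cminus (lambda_sum lam x m) (sum_n a m))) 0).
    - exists m. intros n Hn.
      (* Writing the second [m] as [Nat.min n m] exposes the image of the residual. *)
      rewrite <- (Nat.min_r n m) at 2 by lia.
      rewrite <- lambda_sum_residual_e_lam.
      apply norm_lam_ge, bs_lam_residual; [|intros k]; apply cs_lam_bs_lam;
        [exact Hx | apply cs_lam_e_lam].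
    - apply is_lim_seq_const.
    - exact Ha. }
  pose proof (Cmod_ge_0 (Cminus (lambda_sum lam x m) (sum_n a m))).
  assert (E : Cminus (lambda_sum lam x m) (sum_n a m) = RtoC 0).
  { apply Cmod_eq_0. lra. }
  replace (lambda_sum lam x m)
    with (Cplus (Cminus (lambda_sum lam x m) (sum_n a m)) (sum_n a m)) by C_ring.
  rewrite E. C_ring.
Qed.

Lemma unique_expansion_Lambda (x : nat -> C) :
  cs_lam lam x ->
  unique (fun a => expansion (norm_lam lam) (e_lam lam) a x) (Lambda lam x).
Proof.
  intros Hx. split; [now apply expansion_Lambda|].
  intros a Ha. apply sum_n_inj. now apply expansion_lambda_sum.
Qed.

(** Both summations, the outer one and the weighted one inside [Lambda], are inverted by taking
    differences. *)
Lemma lambda_sum_surjective (T : nat -> C) :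
  exists x, forall m, lambda_sum lam x m = T m.
Proof.
  set (diff := fun (w : nat -> C) k =>
    match k with O => w O | S j => Cminus (w (S j)) (w j) end).
  assert (Hdiff : forall w m, sum_n (diff w) m = w m).
  { intros w m. induction m as [|m IH].
    - now rewrite sum_O.
    - rewrite sum_Sn, IH. change plus with Cplus. simpl. C_ring. }
  assert (dpos : forall k, dlam lam k <> 0).
  { intros [|k]; simpl.
    - specialize (lam_pos O); lra.
    - specialize (lam_incr k); lra. }
  (* [diff T] has to be [Lambda lam x]. Multiplied by [lam n] it is the weighted sum, whose
     differences are the terms [dlam lam k * x k]. *)
  exists (fun k => Cmult (RtoC (/ dlam lam k))
    (diff (fun n => Cmult (RtoC (lam n)) (diff T n)) k)).
  intros m. rewrite <- (Hdiff T m). apply sum_n_ext. intros n.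
  unfold Lambda.
  rewrite (sum_n_ext _ (diff (fun n => Cmult (RtoC (lam n)) (diff T n)))).
  - rewrite Hdiff, Cmult_assoc, <- RtoC_mult, Rinv_l.
    + apply Cmult_1_l.
    + specialize (lam_pos n); lra.
  - intros k. rewrite Cmult_assoc, <- RtoC_mult, Rinv_r by apply dpos.
    apply Cmult_1_l.
Qed.

End Basis.

(** * Countable approximation of finite combinations *)

Lemma R_countable_dense :
  exists r : nat -> R, forall (x eps : R), 0 < eps ->
    exists n, Rabs (x - r n) < eps.
Proof.
  (* An enumeration of the rationals by triples of naturals, with [INR i - INR j] as a signed
     numerator. *)
  exists (fun n => let (p, k) := of_nat n in
                   let (i, j) := of_nat p in (INR i - INR j) / (INR k + 1)).
  intros x eps He.
  destruct (nfloor_ex (/ eps)) as [k [_ Hk]].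
  { apply Rlt_le, Rinv_0_lt_compat, He. }
  set (d := INR k + 1) in *.
  assert (Hd : 0 < d) by (unfold d; pose proof (pos_INR k); lra).
  assert (Hde : / d < eps).
  { rewrite <- (Rinv_inv eps). apply Rinv_lt_contravar; [|exact Hk].
    apply Rmult_lt_0_compat; [apply Rinv_0_lt_compat|]; assumption. }
  assert (Hz : exists i j, Rabs (x * d - (INR i - INR j)) <= 1).
  { destruct (archimed (x * d)) as [H1 H2].
    (* [Z.to_nat] sends negative integers to 0, so the difference of these two naturals is
       [up (x * d)] whatever its sign. *)
    exists (Z.to_nat (up (x * d))), (Z.to_nat (- up (x * d))).
    replace (INR (Z.to_nat (up (x * d))) - INR (Z.to_nat (- up (x * d))))
      with (IZR (up (x * d))).
    - apply Rabs_le. lra.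
    - rewrite !INR_IZR_INZ, <- minus_IZR. f_equal. lia. }
  destruct Hz as [i [j Hij]].
  exists (to_nat (to_nat (i, j), k)). rewrite !cancel_of_to.
  fold d. apply Rle_lt_trans with (/ d); [|exact Hde].
  replace (x - (INR i - INR j) / d) with ((x * d - (INR i - INR j)) * / d)
    by (field; lra).
  rewrite Rabs_mult, (Rabs_pos_eq (/ d)).
  - rewrite <- (Rmult_1_l (/ d)) at 2. apply Rmult_le_compat_r; [|exact Hij].
    now apply Rlt_le, Rinv_0_lt_compat.
  - now apply Rlt_le, Rinv_0_lt_compat.
Qed.

Lemma C_countable_dense :
  exists q : nat -> C, forall (z : C) (eps : R), 0 < eps ->
    exists n, Cmod (Cminus z (q n)) < eps.
Proof.
  destruct R_countable_dense as [r Hr].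
  exists (fun n => let (i, j) := of_nat n in (r i, r j)).
  intros z eps He.
  destruct (Hr (Re z) (eps / 2)) as [i Hi]; [lra|].
  destruct (Hr (Im z) (eps / 2)) as [j Hj]; [lra|].
  exists (to_nat (i, j)). rewrite cancel_of_to.
  replace (Cminus z (r i, r j))
    with (Cplus (RtoC (Re z - r i)) (Cmult Ci (RtoC (Im z - r j)))).
  - eapply Rle_lt_trans; [apply Cmod_triangle|].
    rewrite Cmod_mult, !Cmod_R.
    replace (Cmod Ci) with 1.
    + lra.
    + unfold Cmod, Ci. simpl. rewrite <- sqrt_1 at 1. f_equal. ring.
  - apply injective_projections; unfold Re, Im; simpl; ring.
Qed.

(** Since each [c k] is bounded, approximating the coefficients approximates the combination
    uniformly in [m]. Finitely many coefficients are coded by iterated pairing. *)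
Lemma combinations_countable_dense (c : nat -> nat -> C)
    (c_bounded : forall k, exists M, forall m, Cmod (c k m) <= M) (N : nat) :
  exists f : nat -> nat -> C, forall (a : nat -> C) (eps : R), 0 < eps ->
    exists n, forall m,
      Cmod (Cminus (sum_n (fun k => Cmult (a k) (c k m)) N) (f n m)) <= eps.
Proof.
  destruct C_countable_dense as [q Hq].
  assert (Hterm : forall k z eps, 0 < eps -> exists n, forall m,
    Cmod (Cminus (Cmult z (c k m)) (Cmult (q n) (c k m))) <= eps).
  { intros k z eps He. destruct (c_bounded k) as [M HM].
    assert (HM0 : 0 <= M).
    { eapply Rle_trans; [apply Cmod_ge_0 | apply (HM O)]. }
    (* [M] may be 0; [M + 1] is a positive bound of [c k]. *)
    destruct (Hq z (eps / (M + 1))) as [n Hn].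
    { apply Rdiv_lt_0_compat; lra. }
    exists n. intros m.
    replace (Cminus _ _) with (Cmult (Cminus z (q n)) (c k m)) by C_ring.
    rewrite Cmod_mult.
    replace eps with (eps / (M + 1) * (M + 1)) by (field; lra).
    apply Rmult_le_compat; try apply Cmod_ge_0.
    - now apply Rlt_le.
    - specialize (HM m). lra. }
  induction N as [|N [f Hf]].
  - exists (fun n m => Cmult (q n) (c O m)). intros a eps He.
    destruct (Hterm O (a O) eps He) as [n Hn].
    exists n. intros m. rewrite sum_O. apply Hn.
  - exists (fun n m => let (i, j) := of_nat n in
                       Cplus (f i m) (Cmult (q j) (c (S N) m))).
    intros a eps He.
    destruct (Hf a (eps / 2)) as [i Hi]; [lra|].
    destruct (Hterm (S N) (a (S N)) (eps / 2)) as [j Hj]; [lra|].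
    exists (to_nat (i, j)). intros m. rewrite cancel_of_to, sum_Sn.
    change plus with Cplus. specialize (Hi m). specialize (Hj m).
    match type of Hi with Cmod ?A <= _ => match type of Hj with Cmod ?B <= _ =>
      replace (Cminus _ _) with (Cplus A B) by C_ring end end.
    eapply Rle_trans; [apply Cmod_triangle|]. lra.
Qed.

(** * Diagonalization and the absence of a basis *)

Lemma bounded_sequence_far_from_combinations (c : nat -> nat -> C)
    (c_bounded : forall k, exists M, forall m, Cmod (c k m) <= M) :
  exists T : nat -> C, (forall m, Cmod (T m) <= 1) /\
    forall (a : nat -> C) (N : nat), exists m,
      / 4 <= Cmod (Cminus (T m) (sum_n (fun k => Cmult (a k) (c k m)) N)).
Proof.
  pose proof (combinations_countable_dense c c_bounded) as H.
  apply choice in H. destruct H as [f Hf].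
  (* One enumeration of the approximants for all lengths [N] together. *)
  set (g := fun n => let (N, i) := of_nat n in f N i).
  (* At [m] the value among 0 and 1 that is at least 1/2 away from the real part of [g m m]. *)
  exists (fun m => if Rlt_dec (Re (g m m)) (/ 2) then RtoC 1 else RtoC 0).
  split.
  - intros m. destruct (Rlt_dec _ _); rewrite Cmod_R, Rabs_pos_eq; lra.
  - intros a N. destruct (Hf N a (/ 4)) as [i Hi]; [lra|].
    exists (to_nat (N, i)). set (m := to_nat (N, i)).
    assert (Hg : g m = f N i).
    { unfold g, m. now rewrite cancel_of_to. }
    specialize (Hi m). rewrite <- Hg in Hi.
    set (s := sum_n _ N) in *. set (t := if Rlt_dec _ _ then _ else _).
    assert (Ht : / 2 <= Cmod (Cminus t (g m m))).
    { eapply Rle_trans; [|eapply Rle_trans; [apply Rmax_l|apply Rmax_Cmod]].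
      unfold t. destruct (g m m) as [u v]. simpl.
      destruct (Rlt_dec u (/ 2)); simpl.
      - rewrite Rabs_pos_eq; lra.
      - rewrite Rabs_left1; lra. }
    replace (Cminus t (g m m)) with (Cplus (Cminus t s) (Cminus s (g m m)))
      in Ht by C_ring.
    (* Of the 1/2 gained on the diagonal, the approximation of the combination costs 1/4. *)
    pose proof (Cmod_triangle (Cminus t s) (Cminus s (g m m))). lra.
Qed.

(** The far sequence [T] is the image of some [x] in [bs_lam]. All residuals of [x] then have norm
    at least 1/4, whatever the coefficients. *)
Lemma bs_lam_no_schauder_basis (lam : nat -> R)
  (lam_pos : forall k, 0 < lam k) (lam_incr : forall k, lam k < lam (S k))
  (b : nat -> nat -> C) : ~ schauder_basis (bs_lam lam) (norm_lam lam) b.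
Proof.
  intros [Hb Hexp].
  destruct (bounded_sequence_far_from_combinations
              (fun k => lambda_sum lam (b k)) Hb) as [T [HT Hfar]].
  destruct (lambda_sum_surjective lam lam_pos lam_incr T) as [x Hx].
  assert (Hbx : bs_lam lam x).
  { exists 1. intros m. change (Cmod (lambda_sum lam x m) <= 1).
    now rewrite Hx. }
  destruct (Hexp x Hbx) as [a [Ha _]].
  assert (H : Rbar_le (/ 4) 0).
  { apply (is_lim_seq_le (fun _ => / 4)
             (fun n => norm_lam lam (residual b a x n)) (/ 4) 0).
    - intros n. destruct (Hfar a n) as [m Hm].
      rewrite <- Hx, <- lambda_sum_residual in Hm.
      eapply Rle_trans; [exact Hm|].
      now apply norm_lam_ge, bs_lam_residual.
    - apply is_lim_seq_const.
    - exact Ha. }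
  simpl in H. lra.
Qed.

Theorem theorem4p1 (lam : nat -> R)
  (lam_pos : forall k : nat, 0 < lam k)
  (lam_incr : forall k : nat, lam k < lam (S k))
  (lam_infty : is_lim_seq lam p_infty) :
  (schauder_basis (cs_lam lam) (norm_lam lam) (e_lam lam) /\
   unique_expansions (cs0_lam lam) (norm_lam lam) (e_lam lam) /\
   (forall x : nat -> C, cs_lam lam x \/ cs0_lam lam x ->
      unique (fun a : nat -> C => expansion (norm_lam lam) (e_lam lam) a x)
             (Lambda lam x))) /\
  ~ (exists b : nat -> nat -> C, schauder_basis (bs_lam lam) (norm_lam lam) b).
Proof.
  pose proof (unique_expansion_Lambda lam lam_pos lam_incr) as Hcs.
  assert (Hcs0 : forall x, cs0_lam lam x -> cs_lam lam x).
  { intros x Hx. now exists (RtoC 0). }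
  repeat split.
  - now apply cs_lam_e_lam.
  - intros x Hx. exists (Lambda lam x). now apply Hcs.
  - intros x Hx. exists (Lambda lam x). now apply Hcs, Hcs0.
  (* [repeat split] has also divided [unique] into the expansion and its uniqueness. *)
  - apply Hcs. destruct H; auto.
  - apply Hcs. destruct H; auto.
  - intros [b Hb]. now apply (bs_lam_no_schauder_basis lam lam_pos lam_incr b).
Qed.
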